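(* Define polynomials in $x,y$ (with $I=\sqrt{-1}$) by $$f_{2a}=\frac{5\sqrt5\,y^2-10+5xy+4\sqrt5\,x+16x-\sqrt5\,y+5y+5\sqrt5\,x^2-x^2-4\sqrt5+11\sqrt5\,xy+5y^2}{5(1+\sqrt5)},$$ $$f_{3a}=\frac{\sqrt{50+30\sqrt5}}{125(1+\sqrt5)^3}\Big(250+110\sqrt5x^3+88x^3-420xy+110\sqrt5-192\sqrt5y^2-210\sqrt5x-15\sqrt5y-48\sqrt5x^2+155y^3+366x^2y+348\sqrt5xy^2+336\sqrt5x^2y+97\sqrt5y^3-510x-75y+498xy^2-300\sqrt5xy+30x^2-330y^2\Big),$$ $$f_{2b}=\frac{11\sqrt5\,xy-5xy-\sqrt5\,y+10+5\sqrt5\,y^2+x^2+5\sqrt5\,x^2-5y-16x+4\sqrt5\,x-4\sqrt5-5y^2}{5(-1+\sqrt5)},$$ $$f_{3b}=\frac{I\sqrt{-50+30\sqrt5}}{125(-1+\sqrt5)^3}\Big(-250+110\sqrt5x^3-88x^3+420xy+110\sqrt5-192\sqrt5y^2-210\sqrt5x-15\sqrt5y-48\sqrt5x^2-155y^3-366x^2y+348\sqrt5xy^2+336\sqrt5x^2y+97\sqrt5y^3+510x+75y-498xy^2-300\sqrt5xy-30x^2+330y^2\Big).$$ Then the two sextics $f_a:=f_{2a}^3+f_{3a}^2$ and $f_b:=f_{2b}^3+f_{3b}^2$ are defined over $\mathbf Q(\sqrt5)$, and if $\iota:\mathbf Q(\sqrt5)\to\mathbf Q(\sqrt5)$ is the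 involution given by the Galois automorphism $\iota(\sqrt5)=-\sqrt5$ (acting on coefficients), then $\iota(f_a)=f_b$.
   Context: ''Defined over $\mathbf Q(\sqrt5)$'' means that the polynomials $f_a,f_b\in\mathbf C[x,y]$ have all coefficients in $\mathbf Q(\sqrt5)$. The square roots of real positive numbers are the positive ones. *)

(* Defs.v *)
From HB Require Import structures.
From mathcomp Require Import all_boot all_order all_algebra.
From mathcomp Require Import ring.
From mathcomp Require Import boolp reals.
From mathcomp Require Import complex.
From mathcomp Require Import mpoly.

Set Implicit Arguments.
Unset Strict Implicit.
Unset Printing Implicit Defensive.

Import Order.TTheory GRing.Theory Num.Theory.

Local Open Scope ring_scope.

Section SquareRoots.
Variable R : realType.

(* [Num.sqrt] is the nonnegative square root on [R]; all the radicands used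
   below are positive. *)
Definition csqrt (r : R) : R[i] := (Num.sqrt r)%:C%C.

Definition sqrt5 : R[i] := csqrt 5.

Lemma sqrt5_sqr : sqrt5 * sqrt5 = 5.
Proof.
rewrite /sqrt5 /csqrt -rmorphM /= -expr2 sqr_sqrtr ?ler0n //.
by rewrite rmorph_nat.
Qed.

Lemma ratr_sqrt5_norm (a b c d : rat) :
  ratr (a * b + 5 * (c * d)) =
  ratr a * ratr b + sqrt5 * sqrt5 * (ratr c * ratr d) :> R[i].
Proof.
have <- : ratr 5 = sqrt5 * sqrt5 by rewrite sqrt5_sqr rmorph_nat.
by move: (5 : rat) => e; rewrite !(rmorphD, rmorphM).
Qed.

Lemma rat_sqr_neq5 (q : rat) : q ^+ 2 != 5.
Proof.
apply/eqP => q5.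
have nd : (`|numq q| ^ 2 = 5 * `|denq q| ^ 2)%N.
  have : ((numq q)%:Q) ^+ 2 = 5 * ((denq q)%:Q) ^+ 2.
    by rewrite -q5 -exprMn numqE.
  have -> : (5 : rat) = (5%:Z)%:Q by [].
  rewrite !expr2 -!intrM => /intr_inj /(congr1 absz).
  by rewrite !abszM -!mulnn.
have d0 : (0 < `|denq q|)%N by rewrite absz_gt0 denq_neq0.
have n0 : (0 < `|numq q|)%N.
  by rewrite lt0n; apply/eqP => n0; move: nd; rewrite n0 => /esym/eqP;
     rewrite muln_eq0 expn_eq0 /= andbT; move: d0; rewrite lt0n => /negPf->.
have := congr1 (logn 5) nd.
rewrite lognM ?expn_gt0 ?d0 // !lognX -[logn 5 5]/1%N => /(congr1 odd).
by rewrite oddD !oddM.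
Qed.

Lemma sqrt5_coord_uniq (a b c d : rat) :
  ratr a + ratr b * sqrt5 = ratr c + ratr d * sqrt5 -> a = c /\ b = d.
Proof.
move=> E.
have {}E : ratr (d - b) * sqrt5 = ratr (a - c).
  rewrite !rmorphB /=; apply/eqP; rewrite -subr_eq0.
  have -> : (ratr d - ratr b) * sqrt5 - (ratr a - ratr c) =
      ratr c + ratr d * sqrt5 - (ratr a + ratr b * sqrt5) by ring.
  by rewrite E subrr.
have sq : (d - b) ^+ 2 * 5 = (a - c) ^+ 2.
  apply: (fmorph_inj (@ratr R[i])).
  rewrite [LHS]rmorphM /= rmorph_nat !expr2 !rmorphM /= -E.
  by rewrite [RHS]mulrACA sqrt5_sqr.
have [db|db] := eqVneq (d - b) 0; last first.
  have /eqP := rat_sqr_neq5 ((a - c) / (d - b)).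
  by case; rewrite exprMn exprVn -sq mulrAC divff ?mul1r // expf_neq0.
move: sq; rewrite db expr0n /= mul0r => /esym/eqP.
rewrite sqrf_eq0 subr_eq0 => /eqP ->; split=> //.
by apply/esym/eqP; rewrite -subr_eq0 db.
Qed.

End SquareRoots.

Section QuadraticField.
Variable R : realType.
Local Notation sqrt5 := (sqrt5 R).

Definition Qsqrt5 : {pred R[i]} :=
  fun z => `[< exists a b : rat, z = ratr a + ratr b * sqrt5 >].

Lemma Qsqrt5P (z : R[i]) :
  reflect (exists a b : rat, z = ratr a + ratr b * sqrt5) (z \in Qsqrt5).
Proof. exact: asboolP. Qed.

Lemma Qsqrt5_coord (a b : rat) : ratr a + ratr b * sqrt5 \in Qsqrt5.
Proof. by apply/Qsqrt5P; exists a, b. Qed.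

Lemma Qsqrt5_divring_closed : divring_closed Qsqrt5.
Proof.
have mulQ x y : x \in Qsqrt5 -> y \in Qsqrt5 -> x * y \in Qsqrt5.
  move=> /Qsqrt5P[a [b ->]] /Qsqrt5P[c [d ->]]; apply/Qsqrt5P.
  exists (a * c + 5 * (b * d)), (a * d + b * c).
  rewrite ratr_sqrt5_norm !(rmorphD, rmorphM) /=; ring.
split=> [|x y /Qsqrt5P[a [b ->]] /Qsqrt5P[c [d ->]]|x y xQ yQ].
- by apply/Qsqrt5P; exists 1, 0; rewrite rmorph1 rmorph0 mul0r addr0.
- by apply/Qsqrt5P; exists (a - c), (b - d); rewrite !rmorphB /=; ring.
apply: mulQ => //; move: yQ => /Qsqrt5P[c [d ->]].
set N := c * c + 5 * (d * - d).
have [N0|N0] := eqVneq N 0.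
  have [d0|d0] := eqVneq d 0.
    apply/Qsqrt5P; exists c^-1, 0.
    by rewrite d0 !rmorph0 !mul0r !addr0 fmorphV.
  have /eqP := rat_sqr_neq5 (c / d); case.
  move/eqP: N0; rewrite /N !mulrN subr_eq0 -!expr2 exprMn exprVn => /eqP->.
  by rewrite mulfK // expf_neq0.
apply/Qsqrt5P; exists (c / N), (- d / N).
have NC : ratr N != 0 :> R[i] by rewrite fmorph_eq0.
have NE : (ratr c + ratr d * sqrt5) * (ratr c - ratr d * sqrt5) = ratr N.
  rewrite /N ratr_sqrt5_norm rmorphN /=; ring.
have nz : ratr c + ratr d * sqrt5 != 0.
  by apply: contraNneq NC => z0; rewrite -NE z0 mul0r.
apply: (mulfI nz); rewrite mulfV //.
move: N NC NE {N0} => N NC NE; rewrite !rmorphM rmorphN /= fmorphV.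
transitivity ((ratr c + ratr d * sqrt5) * (ratr c - ratr d * sqrt5) / ratr N).
  by rewrite NE divff.
ring.
Qed.

HB.instance Definition _ :=
  GRing.isDivringClosed.Build R[i] Qsqrt5 Qsqrt5_divring_closed.

Definition Qsqrt5_field := {z : R[i] | z \in Qsqrt5}.

HB.instance Definition _ := SubChoice.on Qsqrt5_field.
HB.instance Definition _ := [SubChoice_isSubComUnitRing of Qsqrt5_field by <:].
HB.instance Definition _ :=
  [SubComUnitRing_isSubIntegralDomain of Qsqrt5_field by <:].
HB.instance Definition _ := [SubIntegralDomain_isSubField of Qsqrt5_field by <:].

Definition Qsqrt5_mk (a b : rat) : Qsqrt5_field :=
  Sub (ratr a + ratr b * sqrt5) (Qsqrt5_coord a b).

Lemma Qsqrt5_surj (z : Qsqrt5_field) :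
  exists ab : rat * rat, z == Qsqrt5_mk ab.1 ab.2.
Proof.
by have /Qsqrt5P[a [b E]] := valP z; exists (a, b); apply/eqP/val_inj.
Qed.

(* The nontrivial automorphism, a + b sqrt5 |-> a - b sqrt5; the chosen
   coordinates are the only ones, by [sqrt5_coord_uniq]. *)
Definition Qsqrt5_conj (z : Qsqrt5_field) : Qsqrt5_field :=
  let ab := xchoose (Qsqrt5_surj z) in Qsqrt5_mk ab.1 (- ab.2).

Lemma Qsqrt5_conj_mk (a b : rat) :
  Qsqrt5_conj (Qsqrt5_mk a b) = Qsqrt5_mk a (- b).
Proof.
rewrite /Qsqrt5_conj.
case: (xchoose _) (xchooseP (Qsqrt5_surj (Qsqrt5_mk a b))).
by move=> c d /= /eqP/(congr1 val)/= /sqrt5_coord_uniq[-> ->].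
Qed.

Lemma Qsqrt5_ind (P : Qsqrt5_field -> Prop) :
  (forall a b, P (Qsqrt5_mk a b)) -> forall z, P z.
Proof. by move=> H z; have [[a b] /eqP->] := Qsqrt5_surj z. Qed.

Lemma Qsqrt5_conj_is_zmod_morphism : zmod_morphism Qsqrt5_conj.
Proof.
elim/Qsqrt5_ind=> a b; elim/Qsqrt5_ind=> c d.
have -> : Qsqrt5_mk a b - Qsqrt5_mk c d = Qsqrt5_mk (a - c) (b - d).
  by apply: val_inj; rewrite rmorphB /= !rmorphB /=; ring.
rewrite !Qsqrt5_conj_mk; apply: val_inj.
rewrite rmorphB /= !(rmorphB, rmorphN) /=.
ring.
Qed.

Lemma Qsqrt5_conj_is_monoid_morphism : monoid_morphism Qsqrt5_conj.
Proof.
split.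
  have -> : 1 = Qsqrt5_mk 1 0.
    by apply: val_inj; rewrite /= rmorph1 rmorph0 mul0r addr0.
  by rewrite Qsqrt5_conj_mk oppr0.
elim/Qsqrt5_ind=> a b; elim/Qsqrt5_ind=> c d.
have mulE p q r s : Qsqrt5_mk p q * Qsqrt5_mk r s =
    Qsqrt5_mk (p * r + 5 * (q * s)) (p * s + q * r).
  apply: val_inj; rewrite rmorphM /= ratr_sqrt5_norm !(rmorphD, rmorphM) /=.
  ring.
rewrite mulE !Qsqrt5_conj_mk mulE; congr Qsqrt5_mk; ring.
Qed.

HB.instance Definition _ :=
  GRing.isZmodMorphism.Build Qsqrt5_field Qsqrt5_field Qsqrt5_conj
    Qsqrt5_conj_is_zmod_morphism.
HB.instance Definition _ :=
  GRing.isMonoidMorphism.Build Qsqrt5_field Qsqrt5_field Qsqrt5_conj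
    Qsqrt5_conj_is_monoid_morphism.

Lemma Qsqrt5_conjK : involutive Qsqrt5_conj.
Proof. by elim/Qsqrt5_ind=> a b; rewrite !Qsqrt5_conj_mk opprK. Qed.

Lemma Qsqrt5_conj_sqrt5 (z : Qsqrt5_field) :
  val z = sqrt5 -> Qsqrt5_conj z = - z.
Proof.
move=> zE; have -> : z = Qsqrt5_mk 0 1.
  by apply: val_inj; rewrite zE /= rmorph0 rmorph1 mul1r add0r.
rewrite Qsqrt5_conj_mk; apply: val_inj.
rewrite rmorphN /= rmorphN rmorph0 [ratr 1]rmorph1; ring.
Qed.

Definition defined_over_Qsqrt5 (f : {mpoly R[i][2]}) : Prop :=
  f \is a mpolyOver 2 Qsqrt5.

Definition Qsqrt5_incl (g : {mpoly Qsqrt5_field[2]}) : {mpoly R[i][2]} :=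
  map_mpoly val g.

Definition Qsqrt5_conj_poly (g : {mpoly Qsqrt5_field[2]}) :
    {mpoly Qsqrt5_field[2]} :=
  map_mpoly Qsqrt5_conj g.

End QuadraticField.

Section Sextics.
Variable R : realType.

Local Notation I := ('i%C : R[i]).
Local Notation s := (sqrt5 R).
Local Notation S := ((sqrt5 R)%:MP_[2]).
Local Notation x := ('X_(@Ordinal 2 0 isT) : {mpoly R[i][2]}).
Local Notation y := ('X_(@Ordinal 2 1 isT) : {mpoly R[i][2]}).

Definition f2a : {mpoly R[i][2]} :=
  (5 * (1 + s))^-1 *:
  (5 * S * y ^+ 2 - 10 + 5 * x * y + 4 * S * x + 16 * x - S * y + 5 * y
   + 5 * S * x ^+ 2 - x ^+ 2 - 4 * S + 11 * S * x * y + 5 * y ^+ 2).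

Definition f3a : {mpoly R[i][2]} :=
  (csqrt (50 + 30 * Num.sqrt 5) / (125 * (1 + s) ^+ 3)) *:
  (250 + 110 * S * x ^+ 3 + 88 * x ^+ 3 - 420 * x * y + 110 * S
   - 192 * S * y ^+ 2 - 210 * S * x - 15 * S * y - 48 * S * x ^+ 2
   + 155 * y ^+ 3 + 366 * x ^+ 2 * y + 348 * S * x * y ^+ 2
   + 336 * S * x ^+ 2 * y + 97 * S * y ^+ 3 - 510 * x - 75 * y
   + 498 * x * y ^+ 2 - 300 * S * x * y + 30 * x ^+ 2 - 330 * y ^+ 2).

Definition f2b : {mpoly R[i][2]} :=
  (5 * (- 1 + s))^-1 *:
  (11 * S * x * y - 5 * x * y - S * y + 10 + 5 * S * y ^+ 2 + x ^+ 2
   + 5 * S * x ^+ 2 - 5 * y - 16 * x + 4 * S * x - 4 * S - 5 * y ^+ 2).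

Definition f3b : {mpoly R[i][2]} :=
  (I * csqrt (- 50 + 30 * Num.sqrt 5) / (125 * (- 1 + s) ^+ 3)) *:
  (- 250 + 110 * S * x ^+ 3 - 88 * x ^+ 3 + 420 * x * y + 110 * S
   - 192 * S * y ^+ 2 - 210 * S * x - 15 * S * y - 48 * S * x ^+ 2
   - 155 * y ^+ 3 - 366 * x ^+ 2 * y + 348 * S * x * y ^+ 2
   + 336 * S * x ^+ 2 * y + 97 * S * y ^+ 3 + 510 * x + 75 * y
   - 498 * x * y ^+ 2 - 300 * S * x * y - 30 * x ^+ 2 + 330 * y ^+ 2).

Definition fa : {mpoly R[i][2]} := f2a ^+ 3 + f3a ^+ 2.

Definition fb : {mpoly R[i][2]} := f2b ^+ 3 + f3b ^+ 2.

End Sextics.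

(* Main.v *)
Require Import Defs.
From mathcomp Require Import all_boot all_order all_algebra.
From mathcomp Require Import reals complex mpoly.
From mathcomp Require Import ring.

(* For a field element s put
     sextic s = (conic(s) / (5 (1 + s)))^3
                + (50 + 30 s) / (125 (1 + s)^3)^2 * cubic(s)^2,
   where the coefficients of conic(s) and cubic(s) are integral affine functions
   of s. Squaring f3a and f3b removes the outer radicals, and fa = sextic sqrt5,
   fb = sextic (- sqrt5). Field morphisms commute with this construction, which
   gives both rationality over Q(sqrt5) and the Galois conjugacy. The degree is
   exactly 6 because, when s^2 = 5, the coefficient of x^6 (read off on the line
   y = 0) is 27 (455 + 201 s) / 25000, and 455 + 201 s has norm 5020. *)

Set Implicit Arguments.
Unset Strict Implicit.
Unset Printing Implicit Defensive.

Import Order.TTheory GRing.Theory Num.Theory.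

Local Open Scope ring_scope.

(** * Upper bounds on the total degree *)

Section DegreeBound.
Variables (n : nat) (F : idomainType).
Implicit Types p q : {mpoly F[n]}.

(** [msize] is one more than the total degree and vanishes at 0, so the zero polynomial satisfies
    every bound. *)
Definition deg_le d p := (msize p <= d.+1)%N.

Lemma deg_leC c : deg_le 0 c%:MP.
Proof. by rewrite /deg_le mmeasureC; case: (c != 0). Qed.

Lemma deg_leX i : deg_le 1 'X_i.
Proof. by rewrite /deg_le msizeX mdeg1. Qed.

Lemma deg_leW d e p : (d <= e)%N -> deg_le d p -> deg_le e p.
Proof. by move=> de dp; apply: leq_trans dp _. Qed.

Lemma deg_leD d p q : deg_le d p -> deg_le d q -> deg_le d (p + q).
Proof.
move=> dp dq; apply: leq_trans (mmeasureD_le _ _ _) _.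
by rewrite geq_max; apply/andP.
Qed.

Lemma deg_leM d e p q : deg_le d p -> deg_le e q -> deg_le (d + e) (p * q).
Proof.
have [->|p0] := eqVneq p 0; first by rewrite mul0r /deg_le mmeasure0.
have [->|q0] := eqVneq q 0; first by rewrite mulr0 /deg_le mmeasure0.
rewrite /deg_le msizeM // => dp dq.
by have := leq_add dp dq; rewrite addSn addnS; case: (_ + _)%N.
Qed.

Lemma deg_leXn d k p : deg_le d p -> deg_le (k * d) (p ^+ k).
Proof.
move=> dp; elim: k => [|k IH]; first by rewrite expr0; apply: deg_leC.
by rewrite exprS mulSn; apply: deg_leM.
Qed.

End DegreeBound.

(** * The family of sextics and its restriction to the line y = 0 *)

Section Plane.
Variable F : fieldType.

Local Notation x := ('X_(@Ordinal 2 0 isT) : {mpoly F[2]}).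
Local Notation y := ('X_(@Ordinal 2 1 isT) : {mpoly F[2]}).

Definition conic (a20 a11 a02 a10 a01 a00 : F) : {mpoly F[2]} :=
  a20%:MP * x ^+ 2 + a11%:MP * (x * y) + a02%:MP * y ^+ 2
  + a10%:MP * x + a01%:MP * y + a00%:MP.

Definition cubic (a30 a21 a12 a03 a20 a11 a02 a10 a01 a00 : F) :
    {mpoly F[2]} :=
  a30%:MP * x ^+ 3 + a21%:MP * (x ^+ 2 * y) + a12%:MP * (x * y ^+ 2)
  + a03%:MP * y ^+ 3 + conic a20 a11 a02 a10 a01 a00.

Lemma deg_conic a20 a11 a02 a10 a01 a00 :
  deg_le 2 (conic a20 a11 a02 a10 a01 a00).
Proof.
rewrite /conic; repeat apply: deg_leD.
- exact: (deg_leM (deg_leC _ _) (deg_leXn _ (deg_leX _ _))).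
- exact: (deg_leM (deg_leC _ _) (deg_leM (deg_leX _ _) (deg_leX _ _))).
- exact: (deg_leM (deg_leC _ _) (deg_leXn _ (deg_leX _ _))).
- exact: (deg_leW _ (deg_leM (deg_leC _ _) (deg_leX _ _))).
- exact: (deg_leW _ (deg_leM (deg_leC _ _) (deg_leX _ _))).
- exact: (deg_leW _ (deg_leC _ _)).
Qed.

Lemma deg_cubic a30 a21 a12 a03 a20 a11 a02 a10 a01 a00 :
  deg_le 3 (cubic a30 a21 a12 a03 a20 a11 a02 a10 a01 a00).
Proof.
rewrite /cubic; apply: deg_leD; last exact: deg_leW (deg_conic _ _ _ _ _ _).
repeat apply: deg_leD.
- exact: (deg_leM (deg_leC _ _) (deg_leXn _ (deg_leX _ _))).
- exact: (deg_leM (deg_leC _ _)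
    (deg_leM (deg_leXn _ (deg_leX _ _)) (deg_leX _ _))).
- exact: (deg_leM (deg_leC _ _)
    (deg_leM (deg_leX _ _) (deg_leXn _ (deg_leX _ _)))).
- exact: (deg_leM (deg_leC _ _) (deg_leXn _ (deg_leX _ _))).
Qed.

Definition sub_x (i : 'I_2) : {poly F} := if i == 0 then 'X else 0.
Local Notation axis := (mmap (@polyC F) sub_x).

(** On the line y = 0 a monomial of degree d becomes 0 or X^d, so degrees cannot grow. A nonzero
    coefficient of the restriction therefore bounds [msize] from below. *)
Lemma size_axis p : (size (axis p) <= msize p)%N.
Proof.
rewrite /mmap (leq_trans (size_sum _ _ _)) //.
apply/bigmax_leqP_seq => m mp _; rewrite mul_polyC.
rewrite (leq_trans (size_scale_leq _ _)) // (leq_trans _ (msize_mdeg_lt mp)) //.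
rewrite /mmap1 big_ord_recl big_ord1 /sub_x /=.
rewrite mdegE big_ord_recl big_ord1 /= expr0n.
(* The case split is on whether the exponent of y is 0. *)
case: eqP => [->|_]; last by rewrite mulr0 size_poly0.
by rewrite mulr1 size_polyXn addn0.
Qed.

Lemma axis_conic a20 a11 a02 a10 a01 a00 :
  axis (conic a20 a11 a02 a10 a01 a00) = Poly [:: a00; a10; a20].
Proof.
rewrite /= !cons_poly_def /conic.
rewrite !rmorphD !(rmorphM,rmorphXn) /= !mmapC !mmapX !mmap1U /sub_x /=.
ring.
Qed.

Lemma axis_cubic a30 a21 a12 a03 a20 a11 a02 a10 a01 a00 :
  axis (cubic a30 a21 a12 a03 a20 a11 a02 a10 a01 a00) =
  Poly [:: a00; a10; a20; a30].
Proof.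
rewrite /cubic rmorphD /= axis_conic /= !cons_poly_def.
rewrite !rmorphD !(rmorphM,rmorphXn) /= !mmapC !mmapX !mmap1U /sub_x /=.
ring.
Qed.

(** At [sqrt5] this and [sextic_cubic] are the polynomial factors of [f2a] and [f3a]; at [- sqrt5]
    they are the negatives of those of [f2b] and [f3b]. *)
Definition sextic_conic s :=
  conic (5 * s - 1) (5 + 11 * s) (5 + 5 * s) (16 + 4 * s) (5 - s)
    (- 10 - 4 * s).

Definition sextic_cubic s :=
  cubic (88 + 110 * s) (366 + 336 * s) (498 + 348 * s) (155 + 97 * s)
    (30 - 48 * s) (- 420 - 300 * s) (- 330 - 192 * s)
    (- 510 - 210 * s) (- 75 - 15 * s) (250 + 110 * s).

Definition sextic s :=
  ((5 * (1 + s))^-1 *: sextic_conic s) ^+ 3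
  + ((50 + 30 * s) / (125 * (1 + s) ^+ 3) ^+ 2) *: sextic_cubic s ^+ 2.

Lemma coef6_cube_add_sqr (a b c d e g h j k : F) :
  ((j *: Poly [:: c; b; a]) ^+ 3 + k *: Poly [:: h; g; e; d] ^+ 2)`_6
  = (j * a) ^+ 3 + k * d ^+ 2.
Proof.
(* All seven coefficients are written out, so that the expansion is a single [ring] identity and the
   last entry can be read off. *)
have -> : (j *: Poly [:: c; b; a]) ^+ 3 + k *: Poly [:: h; g; e; d] ^+ 2 =
  Poly [:: (j * c) ^+ 3 + k * h ^+ 2;
    3 * j ^+ 3 * b * c ^+ 2 + 2 * k * g * h;
    j ^+ 3 * (3 * a * c ^+ 2 + 3 * b ^+ 2 * c) + k * (g ^+ 2 + 2 * e * h);
    j ^+ 3 * (b ^+ 3 + 6 * a * b * c) + 2 * k * (d * h + e * g);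
    j ^+ 3 * (3 * a * b ^+ 2 + 3 * a ^+ 2 * c) + k * (e ^+ 2 + 2 * d * g);
    3 * j ^+ 3 * a ^+ 2 * b + 2 * k * d * e;
    (j * a) ^+ 3 + k * d ^+ 2].
  rewrite /= !cons_poly_def -!mul_polyC; ring.
by rewrite coef_Poly.
Qed.

Lemma coef6_axis_sextic s :
  (axis (sextic s))`_6 =
  ((5 * (1 + s))^-1 * (5 * s - 1)) ^+ 3
  + (50 + 30 * s) / (125 * (1 + s) ^+ 3) ^+ 2 * (88 + 110 * s) ^+ 2.
Proof.
have axisZ k (p : {mpoly F[2]}) : axis (k *: p) = k *: axis p.
  by rewrite mmapZ mul_polyC.
rewrite /sextic rmorphD rmorphXn /= !axisZ rmorphXn /= axis_conic axis_cubic.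
exact: coef6_cube_add_sqr.
Qed.

Lemma msize_sextic_le s : (msize (sextic s) <= 7)%N.
Proof.
rewrite /sextic -!mul_mpolyC; apply: (@deg_leD _ _ 6).
  exact: (deg_leXn 3 (deg_leM (deg_leC _ _) (deg_conic _ _ _ _ _ _))).
exact: (deg_leM (deg_leC _ _) (deg_leXn 2 (deg_cubic _ _ _ _ _ _ _ _ _ _))).
Qed.

End Plane.

(** * Compatibility of the family with field morphisms *)

Lemma map_conic (F K : fieldType) (f : {rmorphism F -> K}) a b c d e g :
  map_mpoly f (conic a b c d e g) =
  conic (f a) (f b) (f c) (f d) (f e) (f g).
Proof.
by rewrite /conic !rmorphD /= !(rmorphXn, rmorphM) /= !map_mpolyC !map_mpolyX.
Qed.

Lemma map_cubic (F K : fieldType) (f : {rmorphism F -> K}) a b c d e g h i j k :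
  map_mpoly f (cubic a b c d e g h i j k) =
  cubic (f a) (f b) (f c) (f d) (f e) (f g) (f h) (f i) (f j) (f k).
Proof.
rewrite /cubic rmorphD /= map_conic.
by rewrite !rmorphD /= !(rmorphXn, rmorphM) /= !map_mpolyC !map_mpolyX.
Qed.

Lemma map_sextic_conic (F K : fieldType) (f : {rmorphism F -> K}) (s : F) :
  map_mpoly f (sextic_conic s) = sextic_conic (f s).
Proof.
rewrite map_conic /sextic_conic.
congr conic; ring.
Qed.

Lemma map_sextic_cubic (F K : fieldType) (f : {rmorphism F -> K}) (s : F) :
  map_mpoly f (sextic_cubic s) = sextic_cubic (f s).
Proof.
rewrite map_cubic /sextic_cubic.
congr cubic; ring.
Qed.

Lemma map_sextic (F K : fieldType) (f : {rmorphism F -> K}) (s : F) :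
  map_mpoly f (sextic s) = sextic (f s).
Proof.
rewrite /sextic rmorphD !rmorphXn /= !map_mpolyZ rmorphXn /=.
rewrite map_sextic_conic map_sextic_cubic.
have -> : f (5 * (1 + s))^-1 = (5 * (1 + f s))^-1.
  by rewrite fmorphV; congr (_^-1); ring.
have -> // : f ((50 + 30 * s) / (125 * (1 + s) ^+ 3) ^+ 2) =
    (50 + 30 * f s) / (125 * (1 + f s) ^+ 3) ^+ 2.
by rewrite rmorphM fmorphV; congr (_ / _); ring.
Qed.

(** The hypothesis covers both square roots of 5, hence both [fa] and [fb]. *)
Lemma msize_sextic (F : numFieldType) (s : F) :
  s ^+ 2 = 5 -> msize (sextic s) = 7%N.
Proof.
move=> s5.
(* Since (1 + s)(s - 1) = s^2 - 1 = 4, the inverse is affine in s, and only numerical denominators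
   remain in the leading coefficient. *)
have invDs : (1 + s)^-1 = (s - 1) / 4.
  have E : (1 + s) * ((s - 1) / 4) = 1.
    have -> : (1 + s) * ((s - 1) / 4) = (s ^+ 2 - 1) / 4 by ring.
    by rewrite s5; field.
  have s1 : 1 + s != 0.
    by apply: contra_eq_neq E => ->; rewrite mul0r eq_sym oner_neq0.
  by apply: (mulfI s1); rewrite mulfV // E.
have lead : (mmap (@polyC F) (@sub_x F) (sextic s))`_6 =
    27 / (25 * 10 ^+ 3) * (455 + 201 * s).
  rewrite coef6_axis_sextic.
  transitivity ((5 * s - 1) ^+ 3 / 5 ^+ 3 * (1 + s)^-1 ^+ 3
      + (50 + 30 * s) / 125 ^+ 2 * (1 + s)^-1 ^+ 6 * (88 + 110 * s) ^+ 2).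
    by rewrite !invfM; ring.
  by rewrite invDs; field: s5.
have lead_neq0 : (mmap (@polyC F) (@sub_x F) (sextic s))`_6 != 0.
  rewrite lead; apply: mulf_neq0.
    by rewrite mulf_neq0 ?invr_neq0 ?mulf_neq0 ?expf_neq0 ?pnatr_eq0.
  (* Multiplying by the conjugate gives 455^2 - 5 * 201^2 = 5020, nonzero in characteristic 0. *)
  have norm : (455 + 201 * s) * (455 - 201 * s) = 502 * 10 by ring: s5.
  have : 502 * 10 != 0 :> F by rewrite mulf_neq0 ?pnatr_eq0.
  by rewrite -norm; apply: contra_neq => ->; rewrite mul0r.
apply/eqP; rewrite eqn_leq msize_sextic_le.
apply: leq_trans (size_axis _); rewrite ltnNge.
(* If the restriction had size at most 6, its coefficient of index 6 would be the default 0. *)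
by apply: contra_neqN lead_neq0 => /(nth_default 0).
Qed.

(** * Identification of [fa] and [fb] with members of the family *)

Section SexticsAsFamily.
Variable R : realType.
Local Notation s := (sqrt5 R).

Lemma f2a_conic : f2a R = (5 * (1 + s))^-1 *: sextic_conic s.
Proof. rewrite /f2a /sextic_conic /conic; congr (_ *: _); ring. Qed.

Lemma f2b_conic : f2b R = (5 * (1 - s))^-1 *: sextic_conic (- s).
Proof.
have -> : 5 * (1 - s) = - (5 * (-1 + s)) by ring.
rewrite invrN scaleNr -scalerN /f2b /sextic_conic /conic; congr (_ *: _); ring.
Qed.

Lemma csqrt_sqr (r : R) : 0 <= r -> csqrt r ^+ 2 = r%:C%C.
Proof. by move=> r0; rewrite /csqrt -rmorphXn /= sqr_sqrtr. Qed.

Lemma f3a_sqr : f3a R ^+ 2 =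
  ((50 + 30 * s) / (125 * (1 + s) ^+ 3) ^+ 2) *: sextic_cubic s ^+ 2.
Proof.
rewrite /f3a exprZn exprMn exprVn csqrt_sqr; last first.
  by rewrite addr_ge0 ?mulr_ge0 ?ler0n ?sqrtr_ge0.
have -> : (50 + 30 * Num.sqrt 5)%:C%C = 50 + 30 * s.
  by rewrite rmorphD rmorphM !rmorph_nat.
(* Setting the scalar aside leaves [ring] an identity free of inverses. *)
have E (p q : {mpoly R[i][2]}) (c : R[i]) : p = q -> c *: p ^+ 2 = c *: q ^+ 2.
  by move->.
apply: E; rewrite /sextic_cubic /cubic /conic; ring.
Qed.

(** The factor i^2 = -1 turns the radicand -50 + 30 s into 50 - 30 s. The signs of the cubic and of
    (-1 + s)^3 disappear on squaring. *)
Lemma f3b_sqr : f3b R ^+ 2 =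
  ((50 + 30 * - s) / (125 * (1 - s) ^+ 3) ^+ 2) *: sextic_cubic (- s) ^+ 2.
Proof.
rewrite /f3b exprZn exprMn exprVn exprMn sqr_i csqrt_sqr; last first.
  (* This makes the radicand nonnegative, as 30 * 2 >= 50. *)
  have s52 : 2 <= Num.sqrt 5 :> R.
    by rewrite -(ler_pXn2r (n := 2)) ?nnegrE ?sqrtr_ge0 // sqr_sqrtr //
      -natrX ler_nat.
  rewrite addrC subr_ge0 (@le_trans _ _ (30 * 2)) ?ler_pM2l ?ltr0n //.
  by rewrite -natrM ler_nat.
have -> : (- 50 + 30 * Num.sqrt 5)%:C%C = - 50 + 30 * s.
  by rewrite rmorphD rmorphN rmorphM !rmorph_nat.
have E (p q : {mpoly R[i][2]}) (c d : R[i]) :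
    c = d -> p = - q -> c *: p ^+ 2 = d *: q ^+ 2.
  by move=> -> ->; rewrite sqrrN.
apply: E; last by rewrite /sextic_cubic /cubic /conic; ring.
have -> : 125 * (1 - s) ^+ 3 = - (125 * (- 1 + s) ^+ 3) by ring.
rewrite sqrrN; congr (_ / _); ring.
Qed.

Lemma fa_sextic : fa R = sextic s.
Proof. by rewrite /fa f2a_conic f3a_sqr. Qed.

Lemma fb_sextic : fb R = sextic (- s).
Proof. by rewrite /fb f2b_conic f3b_sqr. Qed.

End SexticsAsFamily.

Lemma incl_sextic (R : realType) (t : Qsqrt5_field R) :
  Qsqrt5_incl (sextic t) = sextic (val t).
Proof. exact: (map_sextic val). Qed.

Lemma incl_defined_over (R : realType) (g : {mpoly (Qsqrt5_field R)[2]}) :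
  defined_over_Qsqrt5 (Qsqrt5_incl g).
Proof.
apply/mpolyOverP => m; rewrite /Qsqrt5_incl mcoeff_map_mpoly; exact: valP.
Qed.

(** The equalities with 7 say that both curves have degree exactly 6. The involution acts only on
    coefficients in the subfield, so conjugacy is expressed through preimages under
    [Qsqrt5_incl]. *)
Theorem proposition17 (R : realType) :
  [/\ msize (fa R) = 7%N /\ msize (fb R) = 7%N,
      defined_over_Qsqrt5 (fa R),
      defined_over_Qsqrt5 (fb R)
    & exists ga gb : {mpoly (Qsqrt5_field R)[2]},
        [/\ Qsqrt5_incl ga = fa R, Qsqrt5_incl gb = fb R
          & Qsqrt5_conj_poly ga = gb]].
Proof.
(* The square root of 5 as an element of the subfield; the preimages are the family members at t and
   -t. *)
pose t : Qsqrt5_field R := Qsqrt5_mk R 0 1.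
have tE : val t = sqrt5 R by rewrite /= rmorph0 rmorph1 mul1r add0r.
have incl_a : Qsqrt5_incl (sextic t) = fa R by rewrite incl_sextic tE fa_sextic.
have incl_b : Qsqrt5_incl (sextic (- t)) = fb R.
  have tNE : val (- t) = - sqrt5 R by rewrite -tE; apply: rmorphN.
  by rewrite incl_sextic tNE fb_sextic.
split.
- have s5 : sqrt5 R ^+ 2 = 5 by rewrite expr2 sqrt5_sqr.
  have sN5 : (- sqrt5 R) ^+ 2 = 5 by rewrite sqrrN.
  rewrite fa_sextic fb_sextic; split.
    exact: (msize_sextic s5).
  exact: (msize_sextic sN5).
- by rewrite -incl_a; apply: incl_defined_over.
- by rewrite -incl_b; apply: incl_defined_over.
exists (sextic t), (sextic (- t)); split=> //.
(* Once -t is seen as the conjugate of t, the claim is [map_sextic] for the conjugation. *)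
rewrite -(Qsqrt5_conj_sqrt5 tE).
exact: (map_sextic (@Qsqrt5_conj R)).
Qed.
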